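(* Let $d\ge1$, let $\theta$ be a real skew-symmetric $d\times d$ matrix, let $s>0$, let $\Phi$ be a Young function, and let $C>0$ be the constant in the Weyl asymptotic $N(\lambda)\simeq C\lambda^{d/2}$ ($\lambda\to\infty$) for the eigenvalue counting function $N$ of $\Delta$. If $$\sum_{n=1}^\infty\Phi\bigl((n/C)^{-s/d}\bigr)=\infty,$$ then $L_s=(1+\Delta)^{-s/2}\notin\mathcal{S}_\Phi$, and the factorization of the embedding $\iota:W^{s,2}(\mathbb{T}^d_\theta)\hookrightarrow L^2(\mathbb{T}^d_\theta)$ through $\mathcal{S}_\Phi$ as $$W^{s,2}(\mathbb{T}^d_\theta)\xrightarrow{\;T_s\;}\mathcal{S}_\Phi\xrightarrow{\;S\;}L^2(\mathbb{T}^d_\theta),\qquad T_s(x)=L_sx,$$ with $T_s$ and $S$ completely bounded, fails.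
   Context: Quantum torus: $\mathcal{A}_\theta$ is the universal $C^*$-algebra generated by unitaries $U_1,\dots,U_d$ with $U_jU_k=e^{2\pi i\theta_{jk}}U_kU_j$. For $n\in\mathbb{Z}^d$ put $U^n=U_1^{n_1}\cdots U_d^{n_d}$. The canonical trace $\tau$ satisfies $\tau(U^n)=0$ for $n\ne0$ and $\tau(1)=1$; $L^2(\mathbb{T}^d_\theta)$ is its GNS Hilbert space. The derivations $\delta_j$ are densely defined by $\delta_j(U^n)=2\pi i\,n_jU^n$, and the (positive) quantum Laplacian is $\Delta=-\sum_{j=1}^d\delta_j^2$. $N(\lambda)$ is the number of eigenvalues of $\Delta$ that are $\le\lambda$, counted with multiplicity, and $\simeq$ means that the ratio tends to $1$. For $s\ge0$, $W^{s,2}(\mathbb{T}^d_\theta)$ is the completion, for the norm $\|x\|_{W^{s,2}}=\|(1+\Delta)^{s/2}x\|_{L^2}$, of the dense subalgebra of $\mathcal{A}_\theta$ on which it is defined (e.g. polynomials in the $U^n$). A Young function is a convex, increasing $\Phi:[0,\infty)\to[0,\infty)$ with $\Phi(0)=0$ and $\lim_{t\to\infty}\Phi(t)=\infty$. $\mathcal{S}_\Phi$ is the Orlicz–Schatten ideal of operators $T$ on $L^2(\mathbb{T}^d_\theta)$ whose nonincreasing singular value sequence $(\mu_n(T))_{n\ge1}$ satisfies $\sum_n\Phi(\mu_n(T)/\lambda)<\infty$ for some $\lambda>0$, with the Luxemburg norm $\|T\|_{\mathcal{S}_\Phi}=\inf\{\lambda>0:\sum_n\Phi(\mu_n(T)/\lambda)\le1\}$.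 $L_s$ acts on $L^2(\mathbb{T}^d_\theta)$, and $L_sx$ is the product of $L_s$ with $x$, where $x$ acts on $L^2(\mathbb{T}^d_\theta)$ by left multiplication. Spaces carry their natural operator space structures. *)

(* Defs.v *)
From HB Require Import structures.
From mathcomp Require Import all_boot all_order all_algebra.
From mathcomp Require Import all_classical all_reals all_analysis.
From mathcomp Require Import complex.

Set Implicit Arguments.
Unset Strict Implicit.
Unset Printing Implicit Defensive.

Import Order.TTheory GRing.Theory Num.Theory.
Import numFieldNormedType.Exports.

Local Open Scope classical_set_scope.
Local Open Scope ring_scope.
Local Open Scope complex_scope.

(* The norm of a normed module over [R[i]] takes its values in [R[i]]. *)
Definition rnorm (R : realType) (V : normedModType R[i]) (v : V) : R :=
  complex.Re `|v|.

(* The carrier is a Banach space, on which the product is an additional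
   operation: the norm and the ring hierarchies cannot be joined on one carrier
   outside of the library. *)
Record cstarAlg (R : realType) := CStarAlg {
  cstar_sort :> completeNormedModType R[i];
  cmul : cstar_sort -> cstar_sort -> cstar_sort;
  cone : cstar_sort;
  cstar : cstar_sort -> cstar_sort;
  cmulA : forall a b c, cmul a (cmul b c) = cmul (cmul a b) c;
  cmul1l : forall a, cmul cone a = a;
  cmul1r : forall a, cmul a cone = a;
  cmul_linearl : forall (k : R[i]) a b c,
    cmul (k *: a + b) c = k *: cmul a c + cmul b c;
  cmul_linearr : forall (k : R[i]) a b c,
    cmul c (k *: a + b) = k *: cmul c a + cmul c b;
  cstarK : forall a, cstar (cstar a) = a;
  cstar_antilinear : forall (k : R[i]) a b,
    cstar (k *: a + b) = Num.conj k *: cstar a + cstar b;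
  cstarM : forall a b, cstar (cmul a b) = cmul (cstar b) (cstar a);
  cnormM : forall a b, `|cmul a b| <= `|a| * `|b|;
  cstar_identity : forall a, `|cmul (cstar a) a| = `|a| ^+ 2
}.

Arguments cone {R} A : rename.
Notation "a *c b" := (cmul a b) (at level 40, left associativity) : ring_scope.
Notation "a ^c*" := (cstar a) (at level 2, format "a ^c*") : ring_scope.

Section CStar.
Variable R : realType.
Implicit Types A B : cstarAlg R.

Definition unitary A (u : A) : Prop :=
  u^c* *c u = cone A /\ u *c u^c* = cone A.

Definition unital_star_morphism A B (f : A -> B) : Prop :=
  [/\ forall (k : R[i]) (a b : A), f (k *: a + b) = k *: f a + f b,
      f (cone A) = cone B,
      forall a b : A, f (a *c b) = f a *c f b
    & forall a : A, f a^c* = (f a)^c*].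

Definition closed_star_subalgebra A (X : set A) : Prop :=
  [/\ X (cone A),
      forall (k : R[i]) (a b : A), X a -> X b -> X (k *: a + b),
      forall a b : A, X a -> X b -> X (a *c b),
      forall a : A, X a -> X a^c*
    & closed X].

Definition generates A (Y : set A) : Prop :=
  forall X : set A, closed_star_subalgebra X -> Y `<=` X -> X = setT.

End CStar.

Section LinearAlgebra.
Variable R : realType.
Implicit Type V : lmodType R[i].

Definition lin_span V (X : set V) : set V :=
  [set v | exists (k : nat) (c : 'I_k -> R[i]) (x : 'I_k -> V),
     (forall i, X (x i)) /\ v = \sum_(i < k) c i *: x i].

Definition lin_indep V (k : nat) (v : 'I_k -> V) : Prop :=
  forall c : 'I_k -> R[i],
    \sum_(i < k) c i *: v i = 0 -> forall i, c i = 0.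

Definition dimension V (E : set V) : \bar R :=
  ereal_sup [set k%:R%:E | k in
    [set k : nat | exists v : 'I_k -> V,
                     (forall i, E (v i)) /\ lin_indep v]].

End LinearAlgebra.

Section Operators.
Variables (R : realType) (H : completeNormedModType R[i]).

Definition eigenspace (D : set (H * H)) (m : R) : set H :=
  [set v | D (v, m%:C *: v)].

(* Number of eigenvalues [<= l] with multiplicity.  The sum runs over all real
   [m <= l]; those that are not eigenvalues contribute [0]. *)
Definition eigenvalue_count (D : set (H * H)) (l : R) : \bar R :=
  \esum_(m in [set m : R | m <= l]) dimension (eigenspace D m).

(* [f(D)] for a self-adjoint [D] with a total family of eigenvectors: the
   closure of the operator [v |-> f(m) v] on the span of the eigenvectors
   [D v = m v]. *)
Definition functional_calculus (D : set (H * H)) (f : R -> R) :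
    set (H * H) :=
  closure (lin_span
    [set vw : H * H | exists (m : R) (v : H),
       D (v, m%:C *: v) /\ vw = (v, (f m)%:C *: v)]).

End Operators.

Section QuantumTorus.
Variables (R : realType) (d : nat) (theta : 'M[R]_d).

Definition torus_relations (A : cstarAlg R) (U : 'I_d -> A) : Prop :=
  (forall j, unitary (U j)) /\
  forall j k, let t := 2 * pi * theta j k in
    U j *c U k = (cos t +i* sin t) *: (U k *c U j).

(* For a unitary [u], negative powers are powers of [u^-1 = u^c*]. *)
Definition unitary_power (A : cstarAlg R) (u : A) (z : int) : A :=
  match z with
  | Posz k => iter k (cmul u) (cone A)
  | Negz k => iter k.+1 (cmul u^c*) (cone A)
  end.

Definition torus_monomial (A : cstarAlg R) (U : 'I_d -> A)
    (n : 'rV[int]_d) : A :=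
  \big[@cmul R A/cone A]_(j < d) unitary_power (U j) (n 0 j).

Record quantum_torus := QuantumTorus {
  qt_alg : cstarAlg R;
  qt_gen : 'I_d -> qt_alg;
  qt_relations : torus_relations qt_gen;
  qt_generated : generates (range qt_gen);
  qt_universal : forall (B : cstarAlg R) (V : 'I_d -> B),
    torus_relations V ->
    exists! f : qt_alg -> B,
      unital_star_morphism f /\ forall j, f (qt_gen j) = V j;

  qt_trace : {scalar qt_alg};
  qt_trace_bounded : forall a, `|qt_trace a| <= `|a|;
  qt_trace_positive : forall a, 0 <= qt_trace (a^c* *c a);
  qt_trace_tracial : forall a b, qt_trace (a *c b) = qt_trace (b *c a);
  qt_trace1 : qt_trace (cone qt_alg) = 1;
  qt_trace_monomial : forall n : 'rV[int]_d,
    n != 0 -> qt_trace (torus_monomial qt_gen n) = 0;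

  (* GNS construction; [qt_ip] is linear in its first argument *)
  qt_L2 : completeNormedModType R[i];
  qt_ip : {dot qt_L2 for Num.conj};
  qt_normE : forall v : qt_L2, `|v| ^+ 2 = qt_ip v v;
  qt_eta : {linear qt_alg -> qt_L2};
  qt_eta_dense : closure (range qt_eta) = setT;
  qt_ip_eta : forall a b, qt_ip (qt_eta a) (qt_eta b) = qt_trace (b^c* *c a);
  qt_left : qt_alg -> {linear qt_L2 -> qt_L2};
  qt_left_continuous : forall a, continuous (qt_left a);
  qt_left_eta : forall a b, qt_left a (qt_eta b) = qt_eta (a *c b)
}.

Arguments qt_left : clear implicits.
Arguments qt_gen : clear implicits.

Variable T : quantum_torus.
Let H := qt_L2 T.

Definition torus_poly : set (qt_alg T) :=
  lin_span (range (torus_monomial (qt_gen T))).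

(* The closed operator with core the span of the [U^n]. *)
Definition derivation (j : 'I_d) : set (H * H) :=
  closure (lin_span
    [set vw : H * H | exists n : 'rV[int]_d,
       let e := qt_eta T (torus_monomial (qt_gen T) n) in
       vw = (e, (0 +i* (2 * pi * (n 0 j)%:~R)) *: e)]).

Definition laplacian : set (H * H) :=
  [set vw : H * H | exists y z : 'I_d -> H,
     (forall j, derivation j (vw.1, y j) /\ derivation j (y j, z j)) /\
     vw.2 = - \sum_(j < d) z j].

Definition weyl_constant (C : R) : Prop :=
  fine (eigenvalue_count laplacian l) / (C * l `^ (d%:R / 2)) @[l --> +oo]
    --> (1 : R).

(* [(1 + Delta)^p] *)
Definition bessel_power (p : R) : set (H * H) :=
  functional_calculus laplacian (fun m => (1 + m) `^ p).

(* A completion of the polynomials for the norm [||(1 + Delta)^(s/2) x||],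
   with its embedding into [L^2]. *)
Record sobolev_space (s : R) := SobolevSpace {
  sob_space : completeNormedModType R[i];
  sob_of_poly : qt_alg T -> sob_space; (* meaningful on polynomials only *)
  sob_linear : forall (c : R[i]) x y, torus_poly x -> torus_poly y ->
    sob_of_poly (c *: x + y) = c *: sob_of_poly x + sob_of_poly y;
  sob_norm : forall x, torus_poly x ->
    exists2 w : H, bessel_power (s / 2) (qt_eta T x, w)
                 & `|sob_of_poly x| = `|w|;
  sob_dense : closure (sob_of_poly @` torus_poly) = setT;
  sob_emb : {linear sob_space -> H};
  sob_emb_continuous : continuous sob_emb;
  sob_embE : forall x, torus_poly x -> sob_emb (sob_of_poly x) = qt_eta T x
}.

End QuantumTorus.

Arguments qt_left {R d theta} T a : rename.
Arguments qt_gen {R d theta} T j : rename.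
Arguments bessel_power {R d theta} T p.
Arguments derivation {R d theta} T j.
Arguments laplacian {R d theta} T.

Definition young_function (R : realType) (Phi : R -> R) : Prop :=
  [/\ convex_function (`[0, +oo[%classic : set R) Phi,
      forall x y : R, 0 <= x -> x <= y -> Phi x <= Phi y,
      forall x : R, 0 <= x -> 0 <= Phi x,
      Phi 0 = 0
    & Phi x @[x --> +oo] --> +oo].

Section OrliczSchatten.
Variables (R : realType) (H : completeNormedModType R[i]).
Variable ip : {dot H for Num.conj}.

Definition compact_operator (L : H -> H) : Prop :=
  [/\ forall (c : R[i]) (u v : H), L (c *: u + v) = c *: L u + L v,
      continuous L
    & compact (closure (L @` [set v | `|v| <= 1]))].

(* [ker (L^* L - m^2)]: the eigenspace of [|L|] for the eigenvalue [m > 0]. *)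
Definition abs_eigenspace (L : H -> H) (m : R) : set H :=
  [set v | forall w, ip (L v) (L w) = (m ^+ 2)%:C * ip v w].

(* [mu n] is the [(n+1)]-st largest eigenvalue of [|L|]; the list is completed
   by zeros when [L] has finite rank. *)
Definition singular_values (L : H -> H) (mu : nat -> R) : Prop :=
  [/\ compact_operator L,
      forall n, 0 <= mu n,
      forall m n, (m <= n)%N -> mu n <= mu m
    & forall m : R, 0 < m ->
        counting [set n | mu n = m] = dimension (abs_eigenspace L m)].

Definition modular (Phi : R -> R) (mu : nat -> R) (l : R) : \bar R :=
  (\sum_(0 <= n <oo) (Phi (mu n / l))%:E)%E.

Definition orlicz_schatten (Phi : R -> R) : set (H -> H) :=
  [set L | exists2 mu, singular_values L mu &
     exists2 l : R, 0 < l & (modular Phi mu l < +oo)%E].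

Definition luxemburg_norm (Phi : R -> R) (L : H -> H) : R :=
  inf [set l : R | 0 < l /\
    exists2 mu, singular_values L mu & (modular Phi mu l <= 1)%E].

End OrliczSchatten.

Section OperatorSpaces.
Variable R : realType.
Implicit Type V : lmodType R[i].

Definition l2_norm (n : nat) (v : 'cV[R[i]]_n) : R :=
  Num.sqrt (\sum_(i < n) complex.Re `|v i 0| ^+ 2).

Definition mx_opnorm (m n : nat) (a : 'M[R[i]]_(m, n)) : R :=
  inf [set c : R | 0 <= c /\ forall v, l2_norm (a *m v) <= c * l2_norm v].

Definition mx_sandwich V (m n : nat) (a : 'M[R[i]]_(n, m)) (x : 'M[V]_m)
    (b : 'M[R[i]]_(m, n)) : 'M[V]_n :=
  \matrix_(i, j) \sum_(k < m) \sum_(l < m) (a i k * b l j) *: x k l.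

Definition mx_over V (X : set V) (n : nat) (x : 'M[V]_n) : Prop :=
  forall i j, X (x i j).

(* Ruan's axioms for matrix norms [nu] on the linear subspace [X] of [V],
   normed by [N]. *)
Record operator_space V (X : set V) (N : V -> R)
    (nu : forall n, 'M[V]_n -> R) : Prop := OperatorSpace {
  os_ge0 : forall n (x : 'M[V]_n), mx_over X x -> 0 <= nu n x;
  os_eq0 : forall n (x : 'M[V]_n), mx_over X x -> nu n x = 0 -> x = 0;
  os_scale : forall n (c : R[i]) (x : 'M[V]_n), mx_over X x ->
    nu n (map_mx ( *:%R c) x) = complex.Re `|c| * nu n x;
  os_triangle : forall n (x y : 'M[V]_n), mx_over X x -> mx_over X y ->
    nu n (x + y) <= nu n x + nu n y;
  os_sum : forall m n (x : 'M[V]_m) (y : 'M[V]_n),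
    mx_over X x -> mx_over X y ->
    nu (m + n)%N (block_mx x 0 0 y) = Num.max (nu m x) (nu n y);
  os_sandwich : forall m n (a : 'M[R[i]]_(n, m)) (x : 'M[V]_m)
    (b : 'M[R[i]]_(m, n)), mx_over X x ->
    nu n (mx_sandwich a x b) <= mx_opnorm a * nu m x * mx_opnorm b;
  os_norm : forall v, X v -> nu 1%N (const_mx v) = N v
}.

Definition completely_bounded V V' (X : set V) (X' : set V')
    (nu : forall n, 'M[V]_n -> R) (nu' : forall n, 'M[V']_n -> R)
    (f : V -> V') : Prop :=
  [/\ forall x, X x -> X' (f x),
      forall (c : R[i]) x y, X x -> X y -> f (c *: x + y) = c *: f x + f y
    & exists K : R, forall n (x : 'M[V]_n), mx_over X x ->
        nu' n (map_mx f x) <= K * nu n x].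

End OperatorSpaces.

(* The embedding of [W] into [L^2] is [S \o Ts] with [Ts x = Ls x] and with
   both factors completely bounded.  On [W], [Ts] is determined by its values
   on the polynomials, which act by bounded operators. *)
Definition factors_through_orlicz_schatten (R : realType) (d : nat)
    (theta : 'M[R]_d) (T : quantum_torus theta) (s : R)
    (W : sobolev_space T s) (Phi : R -> R) (Ls : qt_L2 T -> qt_L2 T)
    (nuW : forall n, 'M[sob_space W]_n -> R)
    (nuS : forall n, 'M[qt_L2 T -> qt_L2 T]_n -> R)
    (nuH : forall n, 'M[qt_L2 T]_n -> R) : Prop :=
  exists (Ts : sob_space W -> (qt_L2 T -> qt_L2 T))
         (S : (qt_L2 T -> qt_L2 T) -> qt_L2 T),
    [/\ completely_bounded setT (orlicz_schatten (qt_ip T) Phi) nuW nuS Ts,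
        completely_bounded (orlicz_schatten (qt_ip T) Phi) setT nuS nuH S,
        forall x, torus_poly x -> Ts (sob_of_poly W x) = Ls \o qt_left T x
      & forall w, S (Ts w) = sob_emb W w].

(* Main.v *)
Require Import Defs.
From mathcomp Require Import all_boot all_order all_algebra.
From mathcomp Require Import all_classical all_reals all_analysis.
From mathcomp Require Import complex ring.

Set Implicit Arguments.
Unset Strict Implicit.
Unset Printing Implicit Defensive.

Import Order.TTheory GRing.Theory Num.Theory.
Import numFieldNormedType.Exports.

Local Open Scope classical_set_scope.
Local Open Scope ring_scope.

(** The proof compares the singular values of [Ls] with the eigenvalues of the
    Laplacian, using only lower bounds.

    The monomials [U^n] are orthogonal in [L^2], because [(U^m)^* U^n] is a
    multiple of [U^(n-m)], whose trace vanishes for [m <> n]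
    ([monomials_orthogonal]).  Each derivation is therefore skew-symmetric on
    the span of the monomials, and, since an identity between inner products
    survives linear combinations and limits
    ([adjoint_pairs_closure_span]), on its whole domain.  The
    Laplacian is then symmetric and nonnegative, and functions of it are
    symmetric.  An eigenvector of the Laplacian for [m] is thus an eigenvector
    of [|Ls|] for [(1 + m)^(-s/2)] ([eigenspace_sub_abs_eigenspace]).

    Counting with multiplicity, [N(l)] is at most the number of singular
    values [>= (1 + l)^(-s/2)] ([eigenvalue_count_le_counting]).  As [N(l)]
    exceeds [(C/2) l^(d/2)] for large [l], the [n]-th singular value is
    eventually at least [c n^(-s/d)] for some [c > 0]
    ([singular_value_decay]).

    The constant [c], and the parameter [l] of the modular, are absorbed by
    replacing [n] by [k n] in [g(n) = Phi((n/C)^(-s/d))], for some integer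
    [k], and a nonincreasing [g] with divergent series still has
    a divergent series along the multiples of [k] ([nneseries_dilation]).
    Hence every modular of [Ls] is infinite.  Dilating the index instead of
    the values makes the argument uniform in [Phi], which may be very flat
    near [0].

    A factorization through the Orlicz-Schatten class would send the unit of
    the algebra, which acts on [L^2] as the identity, to [Ls] itself
    ([factor_schatten]), so [Ls] would belong to the class. *)

(** * Multiplication of the monomials of the torus *)

Section CStarLinearity.
Variables (R : realType) (A : cstarAlg R).
Implicit Types (a b c : A) (k : R[i]).

Lemma cmul0l a : 0 *c a = 0 :> A.
Proof.
have := cmul_linearl (-1) (0 : A) (0 : A) a.
by rewrite scaler0 add0r scaleN1r addNr.
Qed.

Lemma cmul0r a : a *c 0 = 0 :> A.
Proof.
have := cmul_linearr (-1) (0 : A) (0 : A) a.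
by rewrite scaler0 add0r scaleN1r addNr.
Qed.

Lemma cmulZl k a b : (k *: a) *c b = k *: (a *c b).
Proof. by rewrite -[k *: a]addr0 cmul_linearl cmul0l addr0. Qed.

Lemma cmulZr k a b : a *c (k *: b) = k *: (a *c b).
Proof. by rewrite -[k *: b]addr0 cmul_linearr cmul0r addr0. Qed.

Lemma cstar0 : (0 : A)^c* = 0.
Proof.
have := cstar_antilinear (-1) (0 : A) (0 : A).
by rewrite scaler0 add0r rmorphN rmorph1 scaleN1r addNr.
Qed.

Lemma cstarZ k a : (k *: a)^c* = Num.conj k *: a^c*.
Proof. by rewrite -[k *: a]addr0 cstar_antilinear cstar0 addr0. Qed.

Lemma cstar1 : (cone A)^c* = cone A.
Proof. by rewrite -[LHS]cmul1l -{1}[cone A]cstarK -cstarM cmul1l cstarK. Qed.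

End CStarLinearity.

Section QCommutation.
Variables (R : realType) (A : cstarAlg R).
Implicit Types (a b c u v : A).

(** The factor is unspecified, and may vanish: orthogonality of the monomials
    only needs some factor. *)
Definition proportional a b : Prop := exists k : R[i], a = k *: b.

Definition qcommute a b : Prop := proportional (a *c b) (b *c a).

Lemma proportional_refl a : proportional a a.
Proof. by exists 1; rewrite scale1r. Qed.

Lemma proportional_trans b a c :
  proportional a b -> proportional b c -> proportional a c.
Proof. by move=> [k ->] [l ->]; exists (k * l); rewrite scalerA. Qed.

Lemma proportionalMl c a b : proportional a b -> proportional (c *c a) (c *c b).
Proof. by move=> [k ->]; exists k; rewrite cmulZr. Qed.

Lemma proportionalMr c a b : proportional a b -> proportional (a *c c) (b *c c).
Proof. by move=> [k ->]; exists k; rewrite cmulZl. Qed.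

Lemma qcommute1 a : qcommute a (cone A).
Proof. by exists 1; rewrite cmul1l cmul1r scale1r. Qed.

Lemma qcommuteM a b c : qcommute a b -> qcommute a c -> qcommute a (b *c c).
Proof.
move=> ab ac; rewrite /qcommute cmulA.
apply: proportional_trans (proportionalMr c ab) _.
by rewrite -2!cmulA; exact: proportionalMl.
Qed.

Lemma qcommute_star a b : qcommute a b -> qcommute b^c* a^c*.
Proof. by move=> [k ab]; exists (Num.conj k); rewrite -!cstarM ab cstarZ. Qed.

(** Multiply [v u = k u v] by [u^*] on both sides: this avoids inverting [k]. *)
Lemma qcommute_unitaryVl u v : unitary u -> qcommute v u -> qcommute u^c* v.
Proof.
move=> [uVu uuV] [k vu]; exists k.
rewrite -[LHS]cmul1r -uuV cmulA -[_ *c v *c u]cmulA vu cmulZr cmulZl.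
by rewrite [u^c* *c _]cmulA uVu cmul1l.
Qed.

Lemma qcommute_unitaryVr u v : unitary u -> qcommute u v -> qcommute v u^c*.
Proof.
move=> [uVu uuV] [k uv]; exists k.
rewrite -[LHS]cmul1l -uVu -cmulA [u *c _]cmulA uv cmulZl cmulZr.
by rewrite -[v *c u *c _]cmulA uuV cmul1r.
Qed.

Lemma qcommute_unitary_power a u (z : int) :
  qcommute a u -> qcommute a u^c* -> qcommute a (unitary_power u z).
Proof.
move=> au auV.
have auk w k : qcommute a w -> qcommute a (iter k (cmul w) (cone A)).
  move=> aw; elim: k => [|k IHk]; first exact: qcommute1.
  by rewrite iterS; exact: qcommuteM.
by case: z => k; exact: auk.
Qed.

Lemma unitary_powerS u z :
  unitary u -> u *c unitary_power u z = unitary_power u (z + 1).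
Proof.
move=> [_ uuV]; case: z => k; first by rewrite -PoszD addn1.
(* [- k.+1 + 1] is written [Negz] only when [k] is positive *)
rewrite NegzE intS opprD addrAC addNr add0r.
case: k => [|k]; first by rewrite oppr0 /= cmul1r uuV.
by rewrite -NegzE /= cmulA uuV cmul1l.
Qed.

Lemma unitary_powerB u z :
  unitary u -> u^c* *c unitary_power u z = unitary_power u (z - 1).
Proof.
move=> uu; have [uVu _] := uu; case: (intP z) => [|k|k].
- by rewrite sub0r.
- by rewrite -[in RHS]addn1 PoszD addrK /= cmulA uVu cmul1l.
- by rewrite -opprD -PoszD addn1 -!NegzE.
Qed.

End QCommutation.

Section Degree.
Variables (R : realType) (d : nat) (theta : 'M[R]_d) (A : cstarAlg R).
Variable U : 'I_d -> A.
Hypothesis relU : torus_relations theta U.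
Implicit Types (n m : 'rV[int]_d) (a b : A) (j k : 'I_d).

Let unitU j : unitary (U j). Proof. exact: relU.1. Qed.

Let qcommuteU j k : qcommute (U j) (U k).
Proof. by eexists; exact: relU.2. Qed.

Let qcommuteVU j k : qcommute (U j)^c* (U k).
Proof. exact/qcommute_unitaryVl. Qed.

Let qcommuteUV j k : qcommute (U j) (U k)^c*.
Proof. exact/qcommute_unitaryVr. Qed.

Let qcommuteVV j k : qcommute (U j)^c* (U k)^c*.
Proof. exact: qcommute_star. Qed.

(** Moving [a] to the right past the factors before [P j] only costs scalars;
    there it is absorbed into [Q j]. *)
Lemma qcommute_absorb (r : seq 'I_d) j a (P Q : 'I_d -> A) :
  uniq r -> j \in r -> (forall k, qcommute a (P k)) ->
  a *c P j = Q j -> (forall k, k != j -> Q k = P k) ->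
  proportional (a *c \big[@cmul R A/cone A]_(k <- r) P k)
               (\big[@cmul R A/cone A]_(k <- r) Q k).
Proof.
elim: r => // k r IHr /= /andP[kr ur]; rewrite inE => jr aP aPj QP.
rewrite !big_cons cmulA; have [jk|jk] := eqVneq j k.
  rewrite -jk aPj; apply: proportionalMl.
  rewrite [X in proportional _ X](_ : _ =
    \big[@cmul R A/cone A]_(l <- r) P l); first exact: proportional_refl.
  apply: eq_big_seq => l lr; rewrite QP//.
  by apply: contraNneq kr => lj; rewrite -jk -lj.
have {}jr : j \in r by move: jr; rewrite (negPf jk).
apply: proportional_trans (proportionalMr _ (aP k)) _.
rewrite -cmulA QP; last by rewrite eq_sym.
exact/proportionalMl/IHr.
Qed.

(** The grading of the algebra by [Z^d], seen through the action on monomials;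
    phrased this way, degrees add under products without any computation of the
    commutation phases. *)
Definition has_degree m a : Prop :=
  forall n, proportional (a *c torus_monomial U n) (torus_monomial U (n + m)).

Let eps j : 'rV[int]_d := delta_mx 0 j.

Lemma has_degree_absorb j a (e : int) :
  (forall k z, qcommute a (unitary_power (U k) z)) ->
  (forall z, a *c unitary_power (U j) z = unitary_power (U j) (z + e)) ->
  has_degree (e *: eps j) a.
Proof.
move=> aU aUj n; apply: (qcommute_absorb (j := j)) => //.
- exact: index_enum_uniq.
- by rewrite mem_index_enum.
- by rewrite !mxE !eqxx mulr1.
- by move=> k kj; rewrite !mxE eqxx (negPf kj) mulr0 addr0.
Qed.

Lemma has_degree_gen j : has_degree (1 *: eps j) (U j).
Proof.
apply: has_degree_absorb => [k z|z]; first exact: qcommute_unitary_power.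
exact: unitary_powerS.
Qed.

Lemma has_degree_genV j : has_degree (- 1 *: eps j) (U j)^c*.
Proof.
apply: has_degree_absorb => [k z|z]; first exact: qcommute_unitary_power.
exact: unitary_powerB.
Qed.

Lemma has_degree1 : has_degree 0 (cone A).
Proof. by move=> n; rewrite cmul1l addr0; exact: proportional_refl. Qed.

Lemma has_degreeM m m' a b :
  has_degree m a -> has_degree m' b -> has_degree (m + m') (a *c b).
Proof.
move=> am bm n; rewrite -cmulA.
apply: proportional_trans (proportionalMl a (bm n)) _.
by rewrite [m + m']addrC addrA; exact: am.
Qed.

Lemma has_degree_power_star j z :
  has_degree (- z *: eps j) (unitary_power (U j) z)^c*.
Proof.
have iter_star w m p : has_degree m w^c* ->
    has_degree (m *+ p) (iter p (cmul w) (cone A))^c*.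
  move=> wm; elim: p => [|p IHp]; first by rewrite cstar1; exact: has_degree1.
  by rewrite iterS cstarM mulrSr; exact: has_degreeM.
case: z => p.
  rewrite (_ : _ *: _ = (- 1 *: eps j) *+ p); last first.
    by rewrite scalerMnl mulNrn natz.
  exact/iter_star/has_degree_genV.
rewrite NegzE opprK (_ : _ *: _ = (1 *: eps j) *+ p.+1); last first.
  by rewrite scalerMnl natz.
by apply/iter_star; rewrite cstarK; exact: has_degree_gen.
Qed.

Lemma has_degree_monomial_star m : has_degree (- m) (torus_monomial U m)^c*.
Proof.
rewrite /torus_monomial [m in - m]row_sum_delta -sumrN.
elim/big_ind2: _ => [|x a y b xa yb|j _].
- by rewrite cstar1; exact: has_degree1.
- by rewrite cstarM addrC; exact: has_degreeM.
- by rewrite -scaleNr; exact: has_degree_power_star.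
Qed.

Lemma monomial_star_mul m n :
  proportional ((torus_monomial U m)^c* *c torus_monomial U n)
               (torus_monomial U (n - m)).
Proof. exact: has_degree_monomial_star. Qed.

End Degree.

(** * Symmetric relations in a Hilbert space *)

Section AdjointRelations.
Variables (R : realType) (H : completeNormedModType R[i]).
Variable ip : {dot H for Num.conj}.
Hypothesis normE : forall v : H, `|v| ^+ 2 = ip v v.
Implicit Types (u v w : H) (X Y : set (H * H)).

Lemma ip_conj u v : ip v u = Num.conj (ip u v).
Proof. by rewrite (hermC ip v u) expr0 mul1r. Qed.

(** Cauchy-Schwarz, from the norm of [<v,v> u - <u,v> v]. *)
Lemma ip_bound u v : `|ip u v| <= `|u| * `|v|.
Proof.
have [->|v0] := eqVneq v 0; first by rewrite linear0r !normr0 mulr0.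
have vv : 0 < ip v v by rewrite -normE exprn_gt0// normr_gt0.
rewrite -(@ler_pXn2r _ 2)// ?nnegrE ?mulr_ge0// exprMn !normE normCK -ip_conj.
rewrite -subr_ge0 -(pmulr_rge0 _ vv).
have := exprn_ge0 2 (normr_ge0 (ip v v *: u - ip u v *: v)).
rewrite normE linearBl !linearBr !linearZl_LR !linearZr_LR /=.
rewrite /GRing.scale/= -!ip_conj.
by congr (_ <= _); ring.
Qed.

Lemma ip_continuousl v : continuous (ip^~ v).
Proof.
move=> u; apply/cvgrPdist_lt => e e0.
have v1 : 0 < `|v| + 1 by rewrite ltr_wpDl.
near=> w; rewrite -linearBl /=.
apply: le_lt_trans (ip_bound _ _) _.
apply: (@le_lt_trans _ _ (`|u - w| * (`|v| + 1))).
  by rewrite ler_wpM2l// lerDl.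
rewrite -ltr_pdivlMr//; near: w.
by apply: cvgr_dist_lt; [exact: cvg_id|rewrite divr_gt0].
Unshelve. all: by end_near. Qed.

Lemma closure_zeros (K : numFieldType) (W : normedModType K)
    (V : topologicalType) (F : V -> W) (X : set V) :
  continuous F -> (forall x, X x -> F x = 0) ->
  forall x, closure X x -> F x = 0.
Proof.
move=> Fc FX x Xx; apply/eqP/negPn/negP => Fx0.
by have [y [/FX Fy0 /=]] := Xx _ (cvgr_neq0 _ (Fc x) Fx0); rewrite Fy0 eqxx.
Qed.

(** The relation [X] is contained in [c] times the adjoint of [Y]; for [X = Y],
    the constants [1] and [-1] mean symmetric and skew-symmetric. *)
Definition adjoint_pairs (c : R[i]) X Y : Prop :=
  forall p q, X p -> Y q -> ip p.2 q.1 = c * ip p.1 q.2.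

(** For fixed [q], the defining equation in [p] is linear and closed. *)
Lemma adjoint_pairs_closure_span c X Y :
  adjoint_pairs c X Y -> adjoint_pairs c (closure (lin_span X)) Y.
Proof.
move=> XY p q + Yq; move: p.
pose F (p : H * H) := ip p.2 q.1 - c * ip p.1 q.2.
suff F0 p : closure (lin_span X) p -> F p = 0.
  by move=> p /F0 /eqP; rewrite subr_eq0 => /eqP.
apply: closure_zeros => {p} [p|p [k [a [x [Xx ->]]]]].
  apply: cvgB; [|apply: cvgM; first exact: cvg_cst].
    apply: (@cvg_comp _ _ _ snd (ip^~ q.1)); first exact: cvg_snd.
    exact: ip_continuousl.
  apply: (@cvg_comp _ _ _ fst (ip^~ q.2)); first exact: cvg_fst.
  exact: ip_continuousl.
have E (f : {linear (H * H)%type -> H}) w :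
    ip (f (\sum_(i < k) a i *: x i)) w = \sum_(i < k) a i * ip (f (x i)) w.
  rewrite linear_sum linear_sumlz; apply: eq_bigr => i _.
  by rewrite linearZ linearZl_LR.
rewrite /F (E snd) (E fst) mulr_sumr -sumrB big1// => i _.
by rewrite (XY _ q)// mulrCA subrr.
Qed.

Lemma adjoint_pairs_sym c X Y :
  c * Num.conj c = 1 -> adjoint_pairs c X Y -> adjoint_pairs c Y X.
Proof.
move=> c1 XY q p Yq Xp; rewrite [ip q.1 _]ip_conj (XY p q)//.
by rewrite rmorphM mulrA c1 mul1r; exact: ip_conj.
Qed.

Lemma adjoint_pairs_self_closure_span c X :
  c * Num.conj c = 1 -> adjoint_pairs c X X ->
  adjoint_pairs c (closure (lin_span X)) (closure (lin_span X)).
Proof.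
move=> c1 XX; apply/adjoint_pairs_closure_span/adjoint_pairs_sym => //.
exact/adjoint_pairs_closure_span.
Qed.

Lemma sub_closure_span X : X `<=` closure (lin_span X).
Proof.
move=> p Xp; apply: subset_closure; exists 1, (fun=> 1), (fun=> p).
by split=> //; rewrite big_ord1 scale1r.
Qed.

(** Eigenvectors of [D] for distinct eigenvalues are orthogonal, so both sides
    of the symmetry equation vanish for them; for equal eigenvalues the sides
    agree. *)
Lemma functional_calculus_symmetric (D : set (H * H)) (f : R -> R) :
  adjoint_pairs 1 D D ->
  adjoint_pairs 1 (functional_calculus D f) (functional_calculus D f).
Proof.
move=> DD; apply: adjoint_pairs_self_closure_span.
  by rewrite rmorph1 mulr1.
move=> _ _ [m [v [Dv ->]]] [m' [v' [Dv' ->]]] /=.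
have := DD _ _ Dv Dv'.
have conjR (x : R) : Num.conj x%:C%C = x%:C%C by exact: conjc_real.
rewrite /= !mul1r !linearZl_LR !linearZr_LR /= !conjR => E.
have [->//|mm'] := eqVneq m m'.
suff -> : ip v v' = 0 by rewrite !mulr0.
apply/eqP; move/eqP: E; rewrite -subr_eq0 -mulrBl -rmorphB mulf_eq0.
by rewrite fmorph_eq0 subr_eq0 (negPf mm').
Qed.

End AdjointRelations.

(** * Spectrum of the Laplacian and of the Bessel potentials *)

Section TorusLaplacian.
Variables (R : realType) (d : nat) (theta : 'M[R]_d) (T : quantum_torus theta).
Local Notation ip := (qt_ip T).
Local Notation H := (qt_L2 T).
Local Notation Umon := (torus_monomial (qt_gen T)).

Lemma monomials_orthogonal (n m : 'rV[int]_d) :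
  n != m -> ip (qt_eta T (Umon n)) (qt_eta T (Umon m)) = 0.
Proof.
move=> nm; rewrite qt_ip_eta.
have [k ->] := monomial_star_mul (qt_relations T) m n.
by rewrite linearZ_LR qt_trace_monomial ?subr_eq0//= mulr0.
Qed.

(** The monomials are orthogonal eigenvectors with imaginary eigenvalues. *)
Lemma derivation_skew (j : 'I_d) :
  adjoint_pairs ip (- 1) (derivation T j) (derivation T j).
Proof.
apply: adjoint_pairs_self_closure_span; first exact: qt_normE.
  by rewrite rmorphN rmorph1 mulrNN mulr1.
move=> _ _ [n ->] [m ->] /=; rewrite linearZl_LR linearZr_LR/=.
have [->|nm] := eqVneq n m; last first.
  by rewrite monomials_orthogonal// !mulr0.
rewrite mulN1r -mulNr; congr (_ * _).
by apply: eqP; rewrite eq_complex/= oppr0 opprK !eqxx.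
Qed.

(** Integration by parts: the Laplacian is the sum of the
    [delta_j^* delta_j]. *)
Lemma laplacian_form (v v' : H) (y z y' : 'I_d -> H) :
  (forall j, derivation T j (v, y j) /\ derivation T j (y j, z j)) ->
  (forall j, derivation T j (v', y' j)) ->
  ip (- \sum_j z j) v' = \sum_j ip (y j) (y' j).
Proof.
move=> Dv Dv'; rewrite linearNl linear_sumlz -sumrN; apply: eq_bigr => j _.
by have /= -> := derivation_skew (Dv j).2 (Dv' j); rewrite mulN1r opprK.
Qed.

Lemma laplacian_symmetric : adjoint_pairs ip 1 (laplacian T) (laplacian T).
Proof.
move=> [v w] [v' w'] [y [z [Dv /= ->]]] [y' [z' [Dv' /= ->]]].
rewrite mul1r [RHS]ip_conj (laplacian_form Dv (fun j => (Dv' j).1)).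
rewrite (laplacian_form Dv' (fun j => (Dv j).1)) rmorph_sum.
by apply: eq_bigr => j _; rewrite ip_conj.
Qed.

Lemma laplacian_eigenvalue_ge0 (m : R) (v : H) :
  v != 0 -> laplacian T (v, m%:C%C *: v) -> 0 <= m.
Proof.
move=> v0 [y [z [Dv /= mv]]].
have vv : 0 < ip v v by rewrite -qt_normE exprn_gt0// normr_gt0.
suff : 0 <= m%:C%C * ip v v by rewrite pmulr_lge0// lecR.
rewrite (_ : _ * _ = ip (m%:C%C *: v) v); last by rewrite linearZl_LR.
rewrite mv (laplacian_form Dv (fun j => (Dv j).1)).
by apply: sumr_ge0 => j _; rewrite -qt_normE exprn_ge0.
Qed.

Lemma bessel_eigenvector (p m : R) (v : H) :
  laplacian T (v, m%:C%C *: v) ->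
  bessel_power T p (v, ((1 + m) `^ p)%:C%C *: v).
Proof. by move=> Dv; apply: sub_closure_span; exists m, v. Qed.

(** An eigenvector of the Laplacian is an eigenvector of [L] for a real
    eigenvalue, and [L] is symmetric. *)
Lemma eigenspace_sub_abs_eigenspace (p m : R) (L : H -> H) :
  (forall v w, bessel_power T p (v, w) <-> w = L v) ->
  Defs.eigenspace (laplacian T) m `<=` abs_eigenspace ip L ((1 + m) `^ p).
Proof.
move=> LE v /(bessel_eigenvector (p := p)) /LE Lv w; rewrite -Lv linearZl_LR/=.
have graphL u : bessel_power T p (u, L u) by exact/LE.
have Lsym := functional_calculus_symmetric (@qt_normE _ _ _ T)
  laplacian_symmetric (graphL v) (graphL w).
rewrite /= mul1r in Lsym.
by rewrite -Lsym -Lv linearZl_LR/= mulrA -rmorphM -expr2.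
Qed.

End TorusLaplacian.

(** * Decay of the singular values *)

Section Counting.
Variable R : realType.

Lemma dimension_le (V : lmodType R[i]) (E F : set V) :
  E `<=` F -> (dimension E <= dimension F)%E.
Proof.
move=> EF; apply: ereal_sup_le => _ [k [v [Ev vfree]] <-].
by exists k => //; exists v; split=> // i; exact/EF.
Qed.

Lemma dimension_le0 (V : lmodType R[i]) (E : set V) :
  E `<=` [set 0] -> (dimension E <= 0)%E.
Proof.
move=> E0; apply: ge_ereal_sup => _ [[|k] [v [Ev vfree]] <-]; first exact: lexx.
suff /eqP : (1 : R[i]) = 0 by rewrite oner_eq0.
apply: (vfree (fun=> 1) _ ord0); rewrite big1// => i _.
by rewrite (E0 _ (Ev i)) scaler0.
Qed.

Lemma counting_sub_II (X : set nat) (n : nat) :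
  X `<=` `I_n -> (counting X <= n%:R%:E :> \bar R)%E.
Proof.
have <- : counting `I_n = n%:R%:E :> \bar R.
  by rewrite /counting asboolT// (@card_fset_set _ _ n).
by move=> Xn; apply: le_measure; rewrite ?inE.
Qed.

Lemma esum_le_counting (I : choiceType) (D : set I) (B : I -> set nat)
    (a : I -> \bar R) :
  trivIset D B -> (forall i, D i -> (a i <= counting (B i))%E) ->
  (\esum_(i in D) a i <= counting (\bigcup_(i in D) B i))%E.
Proof.
move=> tB aB; apply: ge_ereal_sup => _ [A [Afin AD] <-].
apply: (@le_trans _ _ (\sum_(i \in A) counting (B i))%E).
  by apply: lee_fsum => // i Ai; exact/aB/AD.
rewrite -measure_fin_bigcup//; last by move=> i j /AD Di /AD Dj; exact: tB.
by apply: le_measure; rewrite ?inE// => n [i /AD Di Bi]; exists i.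
Qed.

End Counting.

Section SingularValues.
Variables (R : realType) (d : nat) (theta : 'M[R]_d) (T : quantum_torus theta).
Variables (p : R) (L : qt_L2 T -> qt_L2 T) (mu : nat -> R).
Hypothesis p0 : 0 < p.
Hypothesis LE : forall v w, bessel_power T (- p) (v, w) <-> w = L v.
Hypothesis muL : singular_values (qt_ip T) L mu.

(** Distinct eigenvalues [m >= 0] give distinct singular values
    [(1 + m)^(-p)], so the multiplicities add up; negative [m] are not
    eigenvalues. *)
Lemma eigenvalue_count_le_counting (l : R) : 0 <= l ->
  (eigenvalue_count (laplacian T) l <=
   counting [set n | ((1 + l) `^ (- p) <= mu n)%R])%E.
Proof.
move=> l0; have [_ mu0 _ muE] := muL.
have pos1 m : 0 <= m -> 0 < 1 + m by move=> m0; rewrite ltr_wpDr.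
pose B m := [set n | 0 <= m /\ mu n = (1 + m) `^ (- p)].
apply: (@le_trans _ _ (counting (\bigcup_(m in [set m | m <= l]) B m))).
  apply: esum_le_counting => [m m' _ _ [n [[m0 nm] [m'0 nm']]]|m ml].
    have: (1 + m) `^ (- p) = (1 + m') `^ (- p) by rewrite -nm.
    rewrite !powRN => /invr_inj /(powR_injective p0) E; apply: (addrI 1).
    by apply: E; rewrite nnegrE ltW// pos1.
  have [m0|m0] := leP 0 m.
    rewrite (_ : B m = [set n | mu n = (1 + m) `^ (- p)]); last first.
      by apply/seteqP; split=> [n []//|n].
    rewrite muE ?powR_gt0 ?pos1//.
    by apply: dimension_le; exact: eigenspace_sub_abs_eigenspace.
  apply: le_trans (measure_ge0 counting _); apply: dimension_le0 => v Dv /=.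
  apply/eqP/negPn/negP => v0; move: m0.
  by rewrite ltNge (laplacian_eigenvalue_ge0 v0 Dv).
apply: le_measure; rewrite ?inE// => n [m /= ml [m0 ->]].
rewrite !powRN lef_pV2 ?posrE ?powR_gt0 ?pos1//.
by apply: ge0_ler_powR; rewrite ?nnegrE ?lerD2l// ltW// pos1.
Qed.

(** Otherwise only the indices below [n] could carry singular values
    [>= (1 + l)^(-p)], too few for the eigenvalues [<= l]. *)
Lemma le_singular_value (l : R) (n : nat) : 0 <= l ->
  (n%:R%:E < eigenvalue_count (laplacian T) l)%E ->
  (1 + l) `^ (- p) <= mu n.
Proof.
move=> l0 nN; rewrite leNgt; apply/negP => mun.
have [_ _ mu_noninc _] := muL.
move: nN; rewrite ltNge => /negP; apply.
apply: le_trans (eigenvalue_count_le_counting l0) _.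
apply: counting_sub_II => m /= lm; rewrite ltnNge; apply/negP => nm.
by move: (lt_le_trans mun lm); rewrite ltNge mu_noninc.
Qed.

(** Weyl's law is used only through [N(l) > (C/2) l^(d/2)] for large [l], at the
    value [l = (2n/C)^(2/d)] for which the bound is exactly [n]; the constant
    [2^(-p)] pays for [1 + l <= 2 l]. *)
Lemma singular_value_decay (C : R) :
  (0 < d)%N -> 0 < C -> weyl_constant T C ->
  exists2 c : R, 0 < c &
    \forall n \near \oo, c * n%:R `^ (- (2 * p / d%:R)) <= mu n.
Proof.
move=> d0 C0 weyl; set a := 2 * p / d%:R.
pose q : R := 2 / d%:R.
have q0 : 0 < q by rewrite divr_gt0 ?ltr0n.
have [l0 [_ count_gt]] : \forall l \near +oo,
    ((C / 2 * l `^ (d%:R / 2))%:E < eigenvalue_count (laplacian T) l)%E.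
  have half1 : 2^-1 < 1 :> R by rewrite invf_lt1// ltr1n.
  near=> l.
  have l0 : 0 < l by near: l; exact: nbhs_pinfty_gt.
  have Cl : 0 < C * l `^ (d%:R / 2) by rewrite mulr_gt0 ?powR_gt0.
  have : 2^-1 < fine (eigenvalue_count (laplacian T) l) / (C * l `^ (d%:R / 2)).
    by near: l; apply: cvgr_gt weyl _ half1.
  rewrite ltr_pdivlMr// mulrCA mulrA => ltfine.
  (* an infinite count would have [fine] equal to [0] *)
  rewrite -[X in (_ < X)%E]fineK ?lte_fin//.
  have: 0 < fine (eigenvalue_count (laplacian T) l).
    by apply: le_lt_trans ltfine; rewrite -mulrA mulrCA mulr_ge0 ?ltW ?invr_gt0.
  by case: eigenvalue_count => //=; rewrite ltxx.
exists (2 `^ (- p) * (2 / C) `^ (- a)).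
  by rewrite mulr_gt0// powR_gt0 ?divr_gt0.
near=> n.
pose M := Num.max l0 1.
have M0 : 0 <= M by rewrite le_max ler01 orbT.
pose x : R := 2 / C * n%:R.
have Mx : M `^ (d%:R / 2) < x.
  rewrite /x -ltr_pdivrMl ?divr_gt0//.
  by near: n; exact: nbhs_infty_gtr.
have x0 : 0 < x by apply: le_lt_trans Mx; exact: powR_ge0.
have qK : d%:R / 2 * q = 1.
  by rewrite /q mulrA divfK// divff// pnatr_eq0 -lt0n.
have Mxq : M < x `^ q.
  rewrite -[M]powRr1// -qK powRrM.
  by apply: gt0_ltr_powR; rewrite ?nnegrE ?powR_ge0// ltW.
have [l0x x1] : l0 < x `^ q /\ 1 < x `^ q by move: Mxq; rewrite gt_max => /andP.
have nN := count_gt _ l0x; rewrite -powRrM [q * _]mulrC qK powRr1 ?ltW// in nN.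
rewrite (_ : C / 2 * x = n%:R) in nN; last by rewrite /x; field; rewrite gt_eqF.
apply: le_trans (le_singular_value (powR_ge0 _ _) nN).
have -> : - a = q * - p by rewrite /a /q mulrN; congr (- _); ring.
have C2 : 0 <= 2 / C by rewrite divr_ge0// ltW.
rewrite -mulrA -powRM// -/x powRrM -powRM ?powR_ge0//.
rewrite !powRN lef_pV2 ?posrE ?powR_gt0 ?mulr_gt0 ?addr_gt0 ?(lt_trans _ x1)//.
apply: ge0_ler_powR; rewrite ?nnegrE; first exact: ltW.
- by rewrite addr_ge0 ?powR_ge0.
- by rewrite mulr_ge0 ?powR_ge0.
- by rewrite mulr_natl mulr2n lerD2r ltW.
Unshelve. all: by end_near. Qed.

End SingularValues.

(** * Divergence along multiples of an integer *)

Section SeriesDilation.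
Variable R : realType.
Implicit Types (f g : nat -> R) (k N M : nat).

(** Each block of [k] consecutive terms of [g], from index [k n] on, is bounded
    by [k] times its first term; the terms below [k N] are kept as they are. *)
Lemma sum_le_dilated_sum f g k N M :
  (0 < N)%N -> (0 < k)%N -> (forall n, 0 <= g n) -> (forall n, 0 <= f n) ->
  (forall m n, (0 < m)%N -> (m <= n)%N -> g n <= g m) ->
  (forall n, (N <= n)%N -> g (k * n)%N <= f n) ->
  \sum_(1 <= m < k * (N + M)) g m <=
  \sum_(1 <= m < k * N) g m + k%:R * \sum_(0 <= n < N + M) f n.
Proof.
move=> N0 k0 g0 f0 g_noninc gf.
elim: M => [|M IHM]; first by rewrite addn0 lerDl mulr_ge0// sumr_ge0.
have kNM : (0 < k * (N + M))%N by rewrite muln_gt0 k0 addn_gt0 N0.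
rewrite addnS mulnS addnC (big_cat_nat _ (n := k * (N + M)))//=; last first.
  exact: leq_addr.
rewrite big_nat_recr//= mulrDr addrA lerD//.
rewrite mulr_natl -[k in f _ *+ k](addKn (k * (N + M))) -sumr_const_nat.
rewrite ler_sum_nat// => m /andP[m_ge _].
by apply: le_trans (gf _ (leq_addr _ _)); exact: g_noninc.
Qed.

Lemma nneseries_dilation f g k N :
  (0 < k)%N -> (forall n, 0 <= g n) -> (forall n, 0 <= f n) ->
  (forall m n, (0 < m)%N -> (m <= n)%N -> g n <= g m) ->
  (forall n, (N <= n)%N -> g (k * n)%N <= f n) ->
  (\sum_(1 <= n <oo) (g n)%:E = +oo :> \bar R)%E ->
  (\sum_(0 <= n <oo) (f n)%:E = +oo :> \bar R)%E.
Proof.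
move=> k0 g0 f0 g_noninc gf gdiv.
have f0E n : (0 <= n)%N -> xpredT n -> (0 <= (f n)%:E)%E by rewrite lee_fin.
have := fun M => nneseries_lim_ge M f0E.
case: (\sum_(0 <= n <oo) (f n)%:E)%E => [B fB|//|/(_ 0%N)]; last first.
  by rewrite big_geq.
have {}fB M : \sum_(0 <= n < M) f n <= B by rewrite -lee_fin -sumEFin fB.
suff : (\sum_(1 <= n <oo) (g n)%:E <=
    (\sum_(1 <= m < k * N.+1) g m + k%:R * B)%:E)%E by rewrite gdiv leye_eq.
apply: lime_le; first by apply: is_cvg_nneseries => n _ _; rewrite lee_fin.
near=> M; rewrite sumEFin lee_fin.
apply: (@le_trans _ _ (\sum_(1 <= m < k * (N.+1 + M)) g m)).
  rewrite [leRHS](big_cat_nat _ (n := M))//=.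
  - by rewrite lerDl sumr_ge0.
  - by near: M; exists 1.
  - by rewrite (leq_trans (leq_addl N.+1 M))// leq_pmull.
apply: le_trans
  (sum_le_dilated_sum (f := f) M (ltn0Sn N) k0 g0 f0 g_noninc _) _.
  by move=> n Nn; apply/gf/ltnW.
by rewrite lerD2l ler_wpM2l.
Unshelve. all: by end_near. Qed.

End SeriesDilation.

(** * Membership in the Orlicz-Schatten class *)

Section Factorization.
Variables (R : realType) (d : nat) (theta : 'M[R]_d) (T : quantum_torus theta).

Lemma torus_monomial0 : torus_monomial (qt_gen T) 0 = cone (qt_alg T).
Proof.
rewrite /torus_monomial; elim/big_ind: _ => [//|_ _ -> ->|j _].
  by rewrite cmul1l.
by rewrite mxE.
Qed.

Lemma torus_poly1 : torus_poly (cone (qt_alg T)).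
Proof.
exists 1%N, (fun=> 1), (fun=> cone (qt_alg T)).
rewrite big_ord1 scale1r; split=> // i; exists 0 => //; exact: torus_monomial0.
Qed.

Lemma left1 v : qt_left T (cone (qt_alg T)) v = v.
Proof.
apply/eqP; rewrite -subr_eq0; apply/eqP.
apply: (@closure_zeros _ _ _ (fun v => qt_left T (cone (qt_alg T)) v - v)
  (range (qt_eta T))); last by rewrite qt_eta_dense.
  by move=> w; apply: cvgB; [exact: qt_left_continuous|exact: cvg_id].
by move=> _ [a _ <-]; rewrite qt_left_eta cmul1l subrr.
Qed.

(** The first factor maps the unit of the algebra to [Ls], and takes its values
    in the Orlicz-Schatten class. *)
Lemma factor_schatten (s : R) (W : sobolev_space T s) (Phi : R -> R)
    (Ls : qt_L2 T -> qt_L2 T) nuW nuS nuH :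
  factors_through_orlicz_schatten (W := W) Phi Ls nuW nuS nuH ->
  orlicz_schatten (qt_ip T) Phi Ls.
Proof.
move=> [Ts [S [[TsS _ _] _ TsE _]]].
rewrite (_ : Ls = Ts (sob_of_poly W (cone (qt_alg T)))); first exact: TsS.
rewrite TsE; last exact: torus_poly1.
by apply/funext => v /=; rewrite left1.
Qed.

End Factorization.

Section BesselPotential.
Variables (R : realType) (d : nat) (theta : 'M[R]_d) (T : quantum_torus theta).

Lemma bessel_potential_notin_schatten (s C : R) (Phi : R -> R)
    (Ls : qt_L2 T -> qt_L2 T) :
  (0 < d)%N -> 0 < s -> young_function Phi -> 0 < C -> weyl_constant T C ->
  (\sum_(1 <= n <oo) (Phi ((n%:R / C) `^ (- (s / d%:R))))%:E
   = +oo :> \bar R)%E ->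
  (forall v w, bessel_power T (- (s / 2)) (v, w) <-> w = Ls v) ->
  ~ orlicz_schatten (qt_ip T) Phi Ls.
Proof.
move=> d0 s0 [_ Phi_mono Phi_ge0 _ _] C0 weyl Phidiv LsE [mu muL [l l0]].
have [_ mu0 _ _] := muL.
have s20 : 0 < s / 2 by rewrite divr_gt0.
have [c c0] := singular_value_decay s20 LsE muL d0 C0 weyl.
rewrite [2 * _]mulrC divfK//; set a := s / d%:R => -[N _ decay].
have a0 : 0 < a by rewrite divr_gt0 ?ltr0n.
(* the least [x] with [(x / C)^(-a) <= c / l], rounded up to an integer [k] *)
pose x := C * (l / c) `^ a^-1.
have x0 : 0 < x by rewrite mulr_gt0 ?powR_gt0 ?divr_gt0.
pose k := Num.bound x.
have xk : x < k%:R by apply: archi_boundP; exact: ltW.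
have kR : 0 < k%:R :> R by exact: lt_trans xk.
have k0 : (0 < k)%N by rewrite -(ltr_nat R).
have kC : (k%:R / C) `^ (- a) <= c / l.
  rewrite powRN -[c / l]invf_div lef_pV2 ?posrE ?powR_gt0 ?divr_gt0//.
  have lc : 0 <= l / c by rewrite divr_ge0// ltW.
  rewrite -[leLHS]powRr1// -[X in _ `^ X](mulVf (lt0r_neq0 a0)) powRrM.
  apply: ge0_ler_powR; rewrite ?nnegrE ?powR_ge0//; first exact: ltW.
    by rewrite divr_ge0// ltW.
  apply: ltW.
  by rewrite ltr_pdivlMr// mulrC.
rewrite /modular (nneseries_dilation (k := k) (N := N) _ _ _ _ _ Phidiv)//.
- by move=> n; exact/Phi_ge0/powR_ge0.
- by move=> n; apply/Phi_ge0; rewrite divr_ge0// ltW.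
- move=> m n m0 mn; apply: Phi_mono; first exact: powR_ge0.
  have mC : 0 < m%:R / C by rewrite divr_gt0 ?ltr0n.
  have nC : 0 < n%:R / C by rewrite divr_gt0 ?ltr0n// (leq_trans m0).
  rewrite !powRN lef_pV2 ?posrE ?powR_gt0//.
  apply: ge0_ler_powR; rewrite ?nnegrE; try exact: ltW.
  by rewrite ler_pM2r ?invr_gt0// ler_nat.
- move=> n Nn; apply: Phi_mono; first exact: powR_ge0.
  have kC0 : 0 <= k%:R / C by rewrite divr_ge0// ltW.
  rewrite natrM mulrAC powRM// ler_pdivlMr//.
  apply: le_trans (decay _ Nn); rewrite mulrAC ler_wpM2r ?powR_ge0//.
  by rewrite -ler_pdivlMr.
Qed.

End BesselPotential.

Theorem proposition4p6 (R : realType) (d : nat) (hd : (1 <= d)%N)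
    (theta : 'M[R]_d) (htheta : theta^T = - theta) (T : quantum_torus theta)
    (s : R) (hs : 0 < s) (Phi : R -> R) (hPhi : young_function Phi)
    (C : R) (hC : 0 < C) (hWeyl : weyl_constant T C)
    (hdiv : (\sum_(1 <= n <oo) (Phi ((n%:R / C) `^ (- (s / d%:R))))%:E
             = +oo :> \bar R)%E)
    (Ls : qt_L2 T -> qt_L2 T)
    (hLs : forall v w, bessel_power T (- (s / 2)) (v, w) <-> w = Ls v) :
  ~ orlicz_schatten (qt_ip T) Phi Ls /\
  forall (W : sobolev_space T s)
    (nuW : forall n, 'M[sob_space W]_n -> R)
    (nuS : forall n, 'M[qt_L2 T -> qt_L2 T]_n -> R)
    (nuH : forall n, 'M[qt_L2 T]_n -> R),
    operator_space setT (@rnorm R (sob_space W)) nuW ->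
    operator_space (orlicz_schatten (qt_ip T) Phi)
      (luxemburg_norm (qt_ip T) Phi) nuS ->
    operator_space setT (@rnorm R (qt_L2 T)) nuH ->
    ~ factors_through_orlicz_schatten Phi Ls nuW nuS nuH.
Proof.
have notS := bessel_potential_notin_schatten hd hs hPhi hC hWeyl hdiv hLs.
by split=> // W nuW nuS nuH _ _ _ /factor_schatten.
Qed.
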